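(* Let $e$ be a positive integer, let $p$ be a prime, and let $H$ be a finite group that can be generated by $e$ elements. Then there is a finite $e$-generated group $\hat H_{p,e}$ (called the $p$-cover of $H$ of rank $e$) such that $\hat H_{p,e}$ is an extension of $H$ with an elementary abelian $p$-group, and every $e$-generated group that is an extension of $H$ with an elementary abelian $p$-group is a quotient of $\hat H_{p,e}$.
   Context: A group is $e$-generated if it can be generated by $e$ elements. A group $G$ is an extension of $Q$ with $N$ if $G$ has a normal subgroup $M\cong N$ with $G/M\cong Q$. Elementary abelian $p$-groups are understood to be finite (the trivial group is allowed). *)

(* Defs.v *)
From HB Require Import structures.
From mathcomp Require Import all_boot all_fingroup all_solvable.

Set Implicit Arguments.
Unset Strict Implicit.
Unset Printing Implicit Defensive.

Local Open Scope group_scope.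

(* The tuple may have repetitions, so this means "at most e distinct generators". *)
Definition generated_by_n (e : nat) (gT : finGroupType) (G : {group gT}) : Prop :=
  exists s : e.-tuple gT, <<[set x in s]>> = G.

Definition is_extension (gT qT nT : finGroupType)
    (G : {group gT}) (Q : {group qT}) (N : {group nT}) : Prop :=
  exists M : {group gT}, [/\ M <| G, M \isog N & G / M \isog Q].

(* An extension of a finite group with a finite group is finite, so letting G
   live in a finGroupType loses no generality. *)
Definition is_abelem_extension (p : nat) (gT qT : finGroupType)
    (G : {group gT}) (Q : {group qT}) : Prop :=
  exists (nT : finGroupType) (N : {group nT}), p.-abelem N /\ is_extension G Q N.

Definition is_quotient_of (kT gT : finGroupType)
    (K : {group kT}) (G : {group gT}) : Prop :=
  exists L : {group gT}, L <| G /\ G / L \isog K.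

(* Main.v *)
(**
  Fix a generating [e]-tuple [h] of [H]. By Gaschuetz's lemma, every
  [e]-generated extension of [H] with an elementary abelian [p]-group has a
  generating tuple above [h]. By Schreier's lemma the order of such an extension
  is at most [p ^ (|H| e) |H|], so one of them, [C], has maximal order. For any
  other one, [K], the tuples of [C] and [K] generate a subgroup of [C * K] which
  is again such an extension and maps onto both; by maximality it is isomorphic
  to [C], hence [K] is a quotient of [C].
*)

Require Import Defs.
From HB Require Import structures.
From mathcomp Require Import all_boot all_fingroup all_solvable.
From Stdlib Require Import Classical.

Set Implicit Arguments.
Unset Strict Implicit.
Unset Printing Implicit Defensive.

Local Open Scope group_scope.

(** * Gaschütz's lemma by counting generating lifts *)

Section Gaschutz.

Variables (I : finType) (aT rT : finGroupType) (G : {group aT}).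
Variable f : {morphism G >-> rT}.

Definition lifts (U : {set aT}) (h : I -> rT) : {set {ffun I -> aT}} :=
  [set t : {ffun I -> aT} | [forall i, (t i \in U) && (f (t i) == h i)]].

Definition gen_lifts (U : {set aT}) (h : I -> rT) : {set {ffun I -> aT}} :=
  [set t in lifts U h | <<[set t i | i in I]>> == U].

Lemma card_fiber (U : {group aT}) (y : rT) :
  U \subset G -> y \in f @* U -> #|[set x in U | f x == y]| = #|'ker_U f|.
Proof.
move=> sUG /morphimP[x Gx Ux ->{y}].
rewrite -(card_rcoset ('ker_U f) x); apply: eq_card => z.
rewrite mem_rcoset !inE; case Uz: (z \in U); last first.
  by rewrite /= groupMr ?groupV // Uz.
have Gz := subsetP sUG z Uz.
rewrite groupM ?groupV //= groupM ?groupV //=.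
by rewrite morphM ?groupV // morphV // -eq_mulgV1.
Qed.

(** The entries of a lift are chosen independently, each from a coset of ['ker_U f]. *)
Lemma card_lifts (U : {group aT}) (h : I -> rT) :
  U \subset G -> (forall i, h i \in f @* U) ->
  #|lifts U h| = (#|'ker_U f| ^ #|I|)%N.
Proof.
move=> sUG hU.
have -> : #|lifts U h| = #|family (fun i => mem [set x in U | f x == h i])|.
  apply: eq_card => t; rewrite inE; apply: eq_forallb => i.
  by rewrite !inE.
rewrite card_family foldrE big_image /= -prod_nat_const.
by apply: eq_bigr => i _; rewrite -(card_fiber sUG (hU i)).
Qed.

(** Lifts are sorted by the subgroup of [U] that they generate. *)
Lemma card_lifts_sum (U : {group aT}) (h : I -> rT) :
  #|lifts U h| = (\sum_(V : {group aT} | V \subset U) #|gen_lifts V h|)%N.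
Proof.
rewrite -sum1_card.
rewrite (partition_big (fun t : {ffun I -> aT} => <<[set t i | i in I]>>%G)
  (fun V : {group aT} => V \subset U)) /=; last first.
  move=> t; rewrite inE gen_subG => /forallP tP.
  by apply/subsetP=> _ /imsetP[i _ ->]; case/andP: (tP i).
apply: eq_bigr => V sVU; rewrite -sum1_card; apply: eq_bigl => t.
rewrite !inE -val_eqE /=; case: eqP => [tV|]; rewrite ?andbT ?andbF //.
apply/forallP/forallP => tP i; case/andP: (tP i) => ti ->; rewrite andbT.
  by rewrite -tV mem_gen ?imset_f.
exact: (subsetP sVU).
Qed.

Lemma gen_lifts_eq0 (U : {group aT}) (h : I -> rT) :
  U \subset G -> <<[set h i | i in I]>> = f @* G -> f @* U != f @* G ->
  gen_lifts U h = set0.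
Proof.
move=> sUG hG; apply: contraNeq => /set0Pn[t].
rewrite !inE => /andP[/forallP tP /eqP tU]; rewrite eqEsubset morphimS //=.
rewrite -hG gen_subG; apply/subsetP=> _ /imsetP[i _ ->].
by have /andP[tiU /eqP <-] := tP i; rewrite mem_morphim // (subsetP sUG).
Qed.

(** Induction on the order of [U]. If [U] maps onto [f @* G], it contains equally many lifts of [h]
    and of [h']; those generating a proper subgroup agree in number by induction, so the remaining
    ones do too. Otherwise both counts are zero. *)
Lemma card_gen_lifts (h h' : I -> rT) (U : {group aT}) :
    <<[set h i | i in I]>> = f @* G -> <<[set h' i | i in I]>> = f @* G ->
  U \subset G -> #|gen_lifts U h| = #|gen_lifts U h'|.
Proof.
move=> hG h'G; have [n] := ubnP #|U|; elim: n U => // n IHn U ltUn sUG.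
have [fU|fU] := eqVneq (f @* U) (f @* G); last by rewrite !gen_lifts_eq0.
have mem_gens k i : <<[set k i | i in I]>> = f @* G -> k i \in f @* U.
  by move=> kG; rewrite fU -kG mem_gen ?imset_f.
have := card_lifts sUG (fun i => mem_gens h i hG).
rewrite -(card_lifts sUG (fun i => mem_gens h' i h'G)) !card_lifts_sum.
rewrite (bigD1 U) //= [RHS](bigD1 U) //= => E; apply/eqP; move/eqP: E.
rewrite (eq_bigr (fun V : {group aT} => #|gen_lifts V h'|)) ?eqn_add2r //.
move=> V /andP[sVU neVU]; apply: IHn; last exact: subset_trans sUG.
by rewrite -ltnS (leq_trans _ ltUn) // ltnS proper_card // properEneq neVU.
Qed.

(* The number of generating tuples of [G] above [h] does not depend on [h], and
   it is positive for the image of a generating tuple of [G]. *)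
Lemma gaschutz (g : I -> aT) (h : I -> rT) :
    <<[set g i | i in I]>> = G -> <<[set h i | i in I]>> = f @* G ->
  exists2 t : I -> aT, <<[set t i | i in I]>> = G & forall i, f (t i) = h i.
Proof.
move=> gG hG; have sgG : [set g i | i in I] \subset G by rewrite -gG subset_gen.
have gGi i : g i \in G by rewrite (subsetP sgG) ?imset_f.
have fgG : <<[set f (g i) | i in I]>> = f @* G.
  have <- : f @* <<[set g i | i in I]>> = f @* G by rewrite gG.
  rewrite morphim_gen // morphimEsub //.
  by rewrite -imset_comp.
have : gen_lifts G (fun i => f (g i)) != set0.
  apply/set0Pn; exists [ffun i => g i]; rewrite !inE; apply/andP; split.
    by apply/forallP=> i; rewrite ffunE gGi /=.
  by under eq_imset => i do rewrite ffunE; rewrite gG.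
rewrite -card_gt0 (card_gen_lifts fgG hG (subxx _)) card_gt0 => /set0Pn[t].
rewrite !inE => /andP[/forallP tP /eqP tG]; exists t => // i.
by have /andP[_ /eqP] := tP i.
Qed.

End Gaschutz.

(** * Schreier generators and the order of an elementary abelian group *)

Lemma schreier_gen (gT : finGroupType) (G M : {group gT}) (S : {set gT}) :
    M \subset G -> <<S>> = G ->
  exists2 B : {set gT}, <<B>> = M & #|B| <= #|G : M| * #|S|.
Proof.
move=> sMG genS; have sSG : S \subset G by rewrite -genS subset_gen.
(* [rep x] depends only on the coset of [x], so [T] is a right transversal of [M] in [G]. *)
pose rep x := repr (M :* x).
pose T := rep @: G.
have repM x : rep x * x^-1 \in M by rewrite -mem_rcoset mem_repr_rcoset.
have sTG : T \subset G.
  apply/subsetP=> _ /imsetP[x Gx ->].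
  by rewrite -(groupMr _ (groupVr Gx)) (subsetP sMG).
pose B := [set t * s * (rep (t * s))^-1 | t in T, s in S].
have sBM : <<B>> \subset M.
  rewrite gen_subG; apply/subsetP=> _ /imset2P[t s _ _ ->].
  by rewrite -groupV invMg invgK.
have cardT : #|T| <= #|G : M|.
  have -> : T = (fun A : {set gT} => repr A) @: rcosets M G.
    by rewrite -imset_comp; apply: eq_imset => x /=; rewrite /rep rcosetE.
  exact: leq_imset_card.
exists B; last first.
  rewrite /B curry_imset2X (leq_trans (leq_imset_card _ _)) //.
  by rewrite cardsX leq_mul2r cardT orbT.
apply/eqP; rewrite eqEsubset sBM /=.
(* [repr] picks 1 in any group, so the transversal represents [M] itself by 1. *)
have rep1 : rep 1 = 1 by rewrite /rep rcoset1 repr_group.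
(* [<<B>> * T] contains 1 and is stable under right multiplication by [S]. As [G] is finite, words
   in [S] without inverses already give all of [G]. *)
have stab x : x \in G -> x \in <<B>> * T.
  rewrite -genS => /gen_prodgP[n [c cS ->]]; elim: n c cS => [|n IHn] c cS.
    rewrite big_ord0 -(mulg1 1) mem_mulg ?group1 //.
    by apply/imsetP; exists 1; rewrite ?group1 ?rep1.
  rewrite big_ord_recr /=.
  have /mulsgP[b t Bb Tt ->] :=
    IHn (fun i => c (widen_ord (leqnSn n) i)) (fun i => cS _).
  set s := c _; have Ss : s \in S by apply: cS.
  have -> : b * t * s = b * (t * s * (rep (t * s))^-1) * rep (t * s).
    by rewrite !mulgA mulgKV.
  apply: mem_mulg; first by apply: groupM => //; apply/mem_gen/imset2_f.
  by apply: imset_f; rewrite groupM ?(subsetP sTG t Tt) ?(subsetP sSG).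
apply/subsetP=> x Mx.
have /mulsgP[b t Bb Tt def_x] := stab x (subsetP sMG x Mx).
have Mt : t \in M by rewrite -(groupMl _ (subsetP sBM _ Bb)) -def_x.
suff t1 : t = 1 by rewrite def_x t1 mulg1.
have /imsetP[y Gy def_t] := Tt.
have My : y \in M by rewrite -groupV -(groupMl _ Mt) def_t.
by rewrite def_t /rep rcoset_id // repr_group.
Qed.

(** The order is [p] to the rank, and for an abelian group the rank is the least number of
    generators. *)
Lemma abelem_card_leq_gen p (gT : finGroupType) (M : {group gT})
    (B : {set gT}) :
  prime p -> p.-abelem M -> <<B>> = M -> #|M| <= p ^ #|B|.
Proof.
move=> pp abM genB; rewrite (card_pgroup (abelem_pgroup abM)).
rewrite leq_exp2l ?prime_gt1 // -(rank_abelem abM).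
by rewrite -(grank_abelian (abelem_abelian abM)) -genB grank_min.
Qed.

(** * Generation, quotients and extensions in terms of families and morphisms *)

Lemma generated_by_nP e (gT : finGroupType) (G : {group gT}) :
  generated_by_n e G <-> exists g : 'I_e -> gT, <<[set g i | i in 'I_e]>> = G.
Proof.
split=> [[s sG]|[g gG]].
  exists (tnth s); rewrite -sG; congr <<_>>; apply/setP=> x; rewrite inE.
  by apply/imsetP/tnthP => [[i _ ->]|[i ->]]; exists i.
exists [tuple g i | i < e]; rewrite -gG; congr <<_>>; apply/setP=> x.
rewrite inE.
apply/tnthP/imsetP => [[i ->]|[i _ ->]]; exists i; rewrite ?tnth_mktuple //.
Qed.

Lemma is_quotient_of_homg (kT gT : finGroupType) (K : {group kT})
    (G : {group gT}) :
  K \homg G -> is_quotient_of K G.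
Proof.
case/homgP=> f fK; exists ('ker f)%G; split; first exact: ker_normal.
by rewrite -fK first_isog.
Qed.

Lemma extension_ker p (kT gT : finGroupType) (K : {group kT})
    (f : {morphism K >-> gT}) (H : {group gT}) :
  f @* K = H -> p.-abelem ('ker f) -> is_abelem_extension p K H.
Proof.
move=> fK abf; exists kT, ('ker f)%G; split=> //.
exists ('ker f)%G; split; [exact: ker_normal | exact: isog_refl |].
by rewrite -fK first_isog.
Qed.

Lemma extension_morphism p (kT gT : finGroupType) (K : {group kT})
    (H : {group gT}) :
  is_abelem_extension p K H ->
  exists2 f : {morphism K >-> gT}, f @* K = H & p.-abelem ('ker f).
Proof.
case=> nT [N [abN [M [nMK isoMN /isogP[g injg gH]]]]].
have sKN := normal_norm nMK.
(* [coset M] has domain ['N(M)], so the composite is repackaged as a morphism on [K]. *)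
have fM : {in K &, {morph g \o coset M : x y / x * y}}.
  move=> x y Kx Ky /=; rewrite !morphM ?mem_quotient ?(subsetP sKN) //.
exists (Morphism fM).
  rewrite -gH morphimEdom /= morphimEdom imset_comp.
  by rewrite -(morphimEsub _ sKN).
rewrite -(isog_abelem isoMN) in abN.
apply: abelemS abN; apply/subsetP=> x /morphpreP[Kx].
rewrite inE /= => /eqP gx1; have Nx := subsetP sKN x Kx.
have : coset M x \in 'ker g by apply/kerP; rewrite ?mem_quotient.
by rewrite (trivgP injg) => /set1P/coset_idr; apply.
Qed.

(** The predicate used later quantifies over all finite group types and is not boolean, hence the
    appeal to excluded middle. *)
Lemma ex_maxn_Prop (P : nat -> Prop) (N n : nat) :
    P n -> (forall m, P m -> m <= N) ->
  exists2 m, P m & forall k, P k -> k <= m.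
Proof.
move=> Pn leN; have [k] := ubnP (N - n); elim: k n Pn => // k IHk n Pn lek.
have [[m [Pm ltnm]]|maxn] := classic (exists m, P m /\ n < m).
  apply: (IHk m Pm); rewrite -ltnS (leq_trans _ lek) // ltnS.
  by rewrite ltn_sub2l // (leq_trans ltnm) ?leN.
by exists n => // m Pm; rewrite leqNgt; apply/negP=> ltnm; case: maxn; exists m.
Qed.

(** * Marked extensions above a fixed tuple, and a maximal one *)

Section AbelemLifts.

Variables (e p : nat) (gT : finGroupType) (h : 'I_e -> gT).

(** Surjectivity of [f] onto the group generated by [h] is automatic, by [morphim_lift]. *)
Definition abelem_lift (cT : finGroupType) (C : {group cT})
    (c : 'I_e -> cT) : Prop :=
  <<[set c i | i in 'I_e]>> = C /\
  exists f : {morphism C >-> gT},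
    (forall i, f (c i) = h i) /\ p.-abelem ('ker f).

Lemma morphim_lift (cT : finGroupType) (C : {group cT}) (c : 'I_e -> cT)
    (f : {morphism C >-> gT}) :
    <<[set c i | i in 'I_e]>> = C -> (forall i, f (c i) = h i) ->
  f @* C = <<[set h i | i in 'I_e]>>.
Proof.
move=> cC fc.
have sC : [set c i | i in 'I_e] \subset C by rewrite -cC subset_gen.
have <- : f @* <<[set c i | i in 'I_e]>> = f @* C by rewrite cC.
rewrite morphim_gen // morphimEsub // -imset_comp; congr <<_>>.
exact: eq_imset.
Qed.

(** The kernel has index [#|H|] in [C], so it has at most [#|H| * e] Schreier generators. *)
Lemma card_lift_leq (cT : finGroupType) (C : {group cT}) (c : 'I_e -> cT)
    (H : {group gT}) :
    prime p -> <<[set h i | i in 'I_e]>> = H -> abelem_lift C c ->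
  #|C| <= p ^ (#|H| * e) * #|H|.
Proof.
move=> pp hH [cC [f [fc abf]]]; have fC := morphim_lift cC fc; rewrite hH in fC.
have sKC : 'ker f \subset C by rewrite subsetIl.
have iC : #|C : 'ker f| = #|H|.
  by rewrite -card_quotient ?normal_norm ?ker_normal //
    (card_isog (first_isog f)) /= fC.
rewrite -(Lagrange sKC) iC leq_mul2r; apply/orP; right.
have [B genB leB] := schreier_gen sKC cC; rewrite iC in leB.
rewrite (leq_trans (abelem_card_leq_gen pp abf genB)) //.
rewrite leq_exp2l ?prime_gt1 // (leq_trans leB) // leq_mul2l.
by rewrite (leq_trans (leq_imset_card _ _)) ?card_ord ?orbT.
Qed.

(* The subdirect product over [h]: generated by the pairs [(c i, k i)], it lies
   in the fibre product of [C] and [K], so its kernel embeds in the product of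
   the two kernels. *)
Lemma lift_subdirect (cT kT : finGroupType) (C : {group cT}) (K : {group kT})
    (c : 'I_e -> cT) (k : 'I_e -> kT) :
    prime p -> abelem_lift C c -> abelem_lift K k ->
  exists D : {group cT * kT},
    [/\ abelem_lift D (fun i => (c i, k i)), C \homg D & K \homg D].
Proof.
move=> pp [cC [f [fc abf]]] [kK [g [gk abg]]].
have Cc i : c i \in C by rewrite -cC mem_gen ?imset_f.
have Kk i : k i \in K by rewrite -kK mem_gen ?imset_f.
pose d i := (c i, k i); pose D := <<[set d i | i in 'I_e]>>%G.
have gE : group_set
    [set u : cT * kT | [&& u.1 \in C, u.2 \in K & f u.1 == g u.2]].
  apply/group_setP; split=> [|u v]; first by rewrite inE !group1 !morph1 eqxx.
  rewrite !inE => /and3P[Cu Ku /eqP Eu] /and3P[Cv Kv /eqP Ev].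
  by rewrite !groupM //= !morphM // Eu Ev eqxx.
have DP u : u \in D -> [/\ u.1 \in C, u.2 \in K & f u.1 = g u.2].
  have sDE : D \subset Group gE.
    rewrite gen_subG; apply/subsetP=> _ /imsetP[i _ ->].
    by rewrite inE /= Cc Kk fc gk eqxx.
  by move/(subsetP sDE); rewrite inE => /and3P[-> -> /eqP->].
exists D; split.
- split=> //.
  have fM : {in D &, {morph (fun u => f u.1) : u v / u * v}}.
    by move=> u v /DP[Cu _ _] /DP[Cv _ _]; rewrite /= morphM.
  exists (Morphism fM); split=> [i|]; first exact: fc.
  (* The second coordinate is killed by [g] because [f u.1 = g u.2] on [D]. *)
  have kerP u : u \in 'ker (Morphism fM) -> u.1 \in 'ker f /\ u.2 \in 'ker g.
    case/morphpreP=> /DP[Cu Ku Eu]; rewrite inE /= => /eqP fu.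
    by split; apply/kerP; rewrite // -Eu.
  case/(abelemP pp): abf => /centsP abf fp.
  case/(abelemP pp): abg => /centsP abg gp.
  apply/(abelemP pp); split.
    apply/centsP=> -[u1 u2] /kerP[/= Ku1 Ku2] [v1 v2] /kerP[/= Kv1 Kv2].
    by congr pair; [exact: abf | exact: abg].
  move=> u /kerP[Ku1 Ku2].
  have expE n : u ^+ n = (u.1 ^+ n, u.2 ^+ n).
    by elim: n => [//|n IHn]; rewrite !expgS IHn.
  by rewrite expE fp ?gp.
- have fstM : {in D &, {morph (fun u : cT * kT => u.1) : u v / u * v}} by [].
  apply/homgP; exists (Morphism fstM); rewrite morphim_gen ?subset_gen //=.
  by rewrite morphimEsub ?subset_gen // -imset_comp -[RHS]cC.
- have sndM : {in D &, {morph (fun u : cT * kT => u.2) : u v / u * v}} by [].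
  apply/homgP; exists (Morphism sndM); rewrite morphim_gen ?subset_gen //=.
  by rewrite morphimEsub ?subset_gen // -imset_comp -[RHS]kK.
Qed.

Lemma maximal_lift (H : {group gT}) :
    prime p -> <<[set h i | i in 'I_e]>> = H ->
  exists (cT : finGroupType) (C : {group cT}) (c : 'I_e -> cT),
    abelem_lift C c /\
    forall (kT : finGroupType) (K : {group kT}) (k : 'I_e -> kT),
      abelem_lift K k -> #|K| <= #|C|.
Proof.
move=> pp hH; set N := (p ^ (#|H| * e) * #|H|)%N.
(* [H] over itself, with trivial kernel, starts the search for a maximum. *)
have lift_H : abelem_lift H h.
  split=> //; exists (idm_morphism H); split=> //.
  by rewrite ker_idm abelem1.
pose P n := exists (cT : finGroupType) (C : {group cT}) (c : 'I_e -> cT),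
  abelem_lift C c /\ #|C| = n.
have [||_ [cT [C [c [liftC <-]]]] maxC] := @ex_maxn_Prop P N #|H|.
- by exists gT, H, h.
- by move=> _ [cT [C [c [liftC <-]]]]; apply: card_lift_leq liftC.
exists cT, C, c; split=> // kT K k liftK.
by apply: maxC; exists kT, K, k.
Qed.

End AbelemLifts.

Theorem theorem1p1 (e p : nat) (he : 0 < e) (hp : prime p)
    (gT : finGroupType) (H : {group gT}) (hH : generated_by_n e H) :
  exists (cT : finGroupType) (C : {group cT}),
    [/\ generated_by_n e C,
        is_abelem_extension p C H
      & forall (kT : finGroupType) (K : {group kT}),
          generated_by_n e K -> is_abelem_extension p K H ->
          is_quotient_of K C].
Proof.
have [h hgen] := (generated_by_nP e H).1 hH.
have [cT [C [c [liftC maxC]]]] := maximal_lift hp hgen.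
exists cT, C; split.
- by case: liftC => cC _; apply/generated_by_nP; exists c.
- case: liftC => cC [f [fc abf]]; apply: extension_ker abf.
  by rewrite (morphim_lift cC fc).
move=> kT K /generated_by_nP[g gK] /extension_morphism[f fK abf].
(* The given generators of [K] are exchanged for generators above the same [h] as those of [C]. *)
have [k kK fk] := gaschutz gK (etrans hgen (esym fK)).
have liftK : abelem_lift p h K k by split=> //; exists f.
have [D [liftD homCD homKD]] := lift_subdirect hp liftC liftK.
apply: is_quotient_of_homg; apply: homg_trans homKD _.
have /homgP[q qD] := homCD.
(* By maximality [D] is no larger than its image [C] under [q], so [q] is injective and [C] inherits
   the map from [D] onto [K]. *)
have := maxC _ _ _ liftD; rewrite -qD => leDq.
have injq : 'injm q by rewrite -card_im_injm eqn_leq leq_morphim.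
by apply/isog_hom/isogP; exists q.
Qed.
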